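(* Let $\varphi=(1+\sqrt5)/2$, and let $\tau_4$ denote the infimum of $\rho(I)$ over all instances $I$ consisting of a planar disk pan, a width $w>0$ and at most four strictly decreasing positive radii, on which some descending greedy execution fails to place the lex-max set. Every failing execution on such an inventory has $\rho>\varphi$. Consequently $\tau_4=\varphi$, and this infimum is not attained (at positive width and strictly decreasing radii).
   Context: Model. Fix a width $w>0$ and a pan, here a closed disk of radius $R$ in the plane. An inventory is a finite list of radii $r_1>r_2>\dots>r_n>0$; ring $i$ has outer radius $r_i$ and hole radius $\max(0,r_i-w)$. A placement of a set $S$ of rings is a forest: each ring of $S$ has as parent either the pan or another ring of $S$ with $r_{\mathrm{child}}\le r_{\mathrm{parent}}-w$, and the children of each common parent must be packable in the parent's region (the pan, or a disk of radius $r-w$ for the hole of a ring of radius $r$), i.e. closed disks having the children's outer radii can be positioned inside that region with pairwise disjoint interiors. Feasibility depends only on the parent assignment (siblings may be rearranged freely). $S$ is feasible if it has a placement. The lex-max set is obtained by scanning the rings in decreasing radius and including ring $i$ whenever the already included rings together with $i$ form a feasible set. A descending greedy execution processes the rings in decreasing radius; when ring $i$ is processed, a container (the pan or the hole of an already placed ring) admits it if the container's current children together with ring $i$ are packable in it; the ring receives some admitting container as its permanent parent (chosen arbitrarily), and is skipped only if no container admits it. An execution fails if it does not place exactly the lex-max set. $\rho=\max_i\bigl(\sum_{j>i}r_j\bigr)/r_i$. *)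

(* Defs.v *)
From HB Require Import structures.
From mathcomp Require Import all_boot all_order all_algebra.
From mathcomp Require Import all_classical all_reals all_analysis.
Set Implicit Arguments.
Unset Strict Implicit.
Unset Printing Implicit Defensive.
Import Order.TTheory GRing.Theory Num.Theory.
Import numFieldNormedType.Exports.
Local Open Scope classical_set_scope.
Local Open Scope ring_scope.

(* The library norm on [R * R] is the sup norm, hence an explicit distance. *)
Definition edist (R : realType) (p q : R * R) : R :=
  Num.sqrt ((p.1 - q.1) ^+ 2 + (p.2 - q.2) ^+ 2).

Definition disk (R : realType) (c : R * R) (s : R) : set (R * R) :=
  [set p | edist p c <= s].

Definition golden (R : realType) : R := (1 + Num.sqrt 5) / 2.

Section Rings.
Variables (R : realType) (n : nat).
(* Rings are indexed by ['I_n] in decreasing order of radius. *)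
Variables (r : 'I_n -> R) (w pan : R).

Definition inventory : Prop :=
  (forall i, 0 < r i) /\ (forall i j : 'I_n, (i < j)%N -> r j < r i).

(* A container is [None] for the pan, [Some j] for the hole of ring [j]. *)
Definition region_radius (c : option 'I_n) : R :=
  if c is Some j then Num.max 0 (r j - w) else pan.

Definition packable (A : {set 'I_n}) (s : R) : Prop :=
  exists ctr : 'I_n -> R * R,
    (forall i, i \in A -> disk (ctr i) (r i) `<=` disk (0, 0) s) /\
    (forall i j, i \in A -> j \in A -> i != j ->
       (disk (ctr i) (r i))° `&` (disk (ctr j) (r j))° = set0).

(* The values of [parent] outside [S] are irrelevant; acyclicity follows from
   [r i <= r j - w] when [0 < w]. *)
Definition placement (S : {set 'I_n}) (parent : 'I_n -> option 'I_n) : Prop :=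
  (forall i j, i \in S -> parent i = Some j -> j \in S /\ r i <= r j - w) /\
  (forall c : option 'I_n,
     packable [set i in S | parent i == c]%SET (region_radius c)).

Definition feasible (S : {set 'I_n}) : Prop := exists parent, placement S parent.

Definition lexmax : {set 'I_n} :=
  foldl (fun S i => if `[< feasible (i |: S)%SET >] then (i |: S)%SET else S)
    finset.set0 (enum 'I_n).

(* The outcome of an execution: [f i = Some c] if ring [i] was placed in the
   container [c], and [f i = None] if it was skipped. The state in which ring
   [i] is processed is the restriction of [f] to the rings [k < i]. *)
Definition outcome := 'I_n -> option (option 'I_n).

Definition available (f : outcome) (i : 'I_n) (c : option 'I_n) : Prop :=
  if c is Some j then (j < i)%N /\ f j <> None else True.

Definition admits (f : outcome) (i : 'I_n) (c : option 'I_n) : Prop :=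
  available f i c /\
  packable (i |: [set k : 'I_n | (k < i)%N & f k == Some c])%SET
    (region_radius c).

Definition greedy_execution (f : outcome) : Prop :=
  forall i, if f i is Some c then admits f i c else forall c, ~ admits f i c.

Definition fails (f : outcome) : Prop := [set i | f i != None]%SET <> lexmax.

(* The base value 0 is harmless: the term of the last ring is 0. *)
Definition rho : R :=
  \big[Num.max/0]_(i < n) ((\sum_(j < n | (i < j)%N) r j) / r i).

End Rings.

Definition failing_ratios (R : realType) (m : nat) : set R :=
  [set x | exists (n : nat) (r : 'I_n -> R) (w pan : R),
     [/\ (n <= m)%N, inventory r, 0 < w & 0 < pan] /\
     (exists f, greedy_execution r w pan f /\ fails r w pan f) /\
     x = rho r].
Arguments failing_ratios R m : clear implicits.

Definition tau (R : realType) (m : nat) : R := inf (failing_ratios R m).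

(* Main.v *)
Require Import Defs.
From mathcomp Require Import all_boot all_order all_algebra.
From mathcomp Require Import all_classical all_reals all_analysis.
From mathcomp Require Import ring lra zify.
Set Implicit Arguments.
Unset Strict Implicit.
Unset Printing Implicit Defensive.
Import Order.TTheory GRing.Theory Num.Theory.
Import numFieldNormedType.Exports.
Local Open Scope ring_scope.

(** Compare a failing execution with the lex-max scan at the first ring [i] on
which they differ, and let [T] be the set of rings placed before [i].  The
greedy parents of [T] always form a placement ([greedy_placement]), so the
difference can only be that [i] is skipped although [i |: T] is feasible
([fails_first_skip]).  Let [g] be the greedy parents of [T] and [q] the parents
of a placement of [i |: T].

The comparison of [g] and [q] is pure combinatorics, driven by two exchange
principles.  A hole that [g] leaves empty is too small for [i], hence for every
ring of [i |: T], so [q] leaves it empty too ([optimal_avoids_childless]).  And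
if [g] has only the ring [k] in a container, then in [q] no ring at least as
large as [k] shares that container with another ring, as otherwise [k] and [i]
would fit there together ([optimal_no_company]).  These rule out [#|T| <= 2],
and for [T] consisting of [a], [b], [c] in decreasing order of radius they
leave only situations in which [a] and [b] fit together in the pan, but
[a], [b] and [i] do not ([stuck_triple]).

Write x > y > z > u for the radii of these four rings.  The pan has radius at
least x + y, and in a pan of radius exactly x + y, with the two large disks
along a diameter, the gap beside them holds disks of radius up to
x y (x + y) / (x^2 + x y + y^2) (Descartes' circle theorem; the centre of the
largest such disk is rational in x and y, see [exists_third_center]).  Hence u
exceeds this bound, and so does z.  If x <= phi y this forces
y + z + u > phi x, and if x >= phi y it forces z + u > phi y
([ratio_exceeds_golden]): the two bounds cross exactly at x = phi y.

At the crossing, x = 1 and y = phi - 1, the gap has radius 1/2.  Taking z and u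
slightly above 1/2 gives failing executions with rho arbitrarily close to phi
([failing_ratio_near_golden]): in a pan of radius 1 + y greedy puts the second
ring beside the first one and the third ring in the hole, and the fourth ring
fits nowhere, whereas with the second ring in the hole the other three fit in
the pan.  That 1 and y leave no room for u there is Stewart's theorem
([tight_third_disk]). *)

(* The name [edist] also denotes an extended distance of the libraries. *)
Local Notation edist := Defs.edist.

(** * Disks in the Euclidean plane *)

Section Euclid.
Variable R : realType.
Implicit Types (p q x c : R * R) (s t : R).

Lemma edist_ge0 p q : 0 <= edist p q.
Proof. exact: sqrtr_ge0. Qed.

Lemma sqr_edist p q :
  edist p q ^+ 2 = (p.1 - q.1) ^+ 2 + (p.2 - q.2) ^+ 2.
Proof. by rewrite sqr_sqrtr // addr_ge0 ?sqr_ge0. Qed.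

Lemma edistC p q : edist p q = edist q p.
Proof. by rewrite /edist -(opprB q.1) sqrrN -(opprB q.2) sqrrN. Qed.

Lemma edist_le0 p q : edist p q <= 0 -> p = q.
Proof.
move=> pq; have {}pq : edist p q = 0 by apply/eqP; rewrite eq_le pq edist_ge0.
have := sqr_edist p q; rewrite pq expr0n /= => /esym/eqP.
rewrite paddr_eq0 ?sqr_ge0 // !sqrf_eq0 !subr_eq0 => /andP[/eqP h1 /eqP h2].
by rewrite [p]surjective_pairing h1 h2 -surjective_pairing.
Qed.

Lemma edist_le p q s : 0 <= s ->
  (p.1 - q.1) ^+ 2 + (p.2 - q.2) ^+ 2 <= s ^+ 2 -> edist p q <= s.
Proof.
by move=> s0; rewrite -sqr_edist ler_sqr // nnegrE // edist_ge0.
Qed.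

Lemma le_edist p q s : 0 <= s ->
  s ^+ 2 <= (p.1 - q.1) ^+ 2 + (p.2 - q.2) ^+ 2 -> s <= edist p q.
Proof.
by move=> s0; rewrite -sqr_edist ler_sqr // nnegrE // edist_ge0.
Qed.

Lemma edist_triangle x p q : edist p q <= edist p x + edist x q.
Proof.
have p0 := edist_ge0 p x; have q0 := edist_ge0 x q.
apply: edist_le; first exact: addr_ge0.
rewrite [leRHS]sqrrD !sqr_edist.
set u1 := p.1 - x.1; set u2 := p.2 - x.2.
set v1 := x.1 - q.1; set v2 := x.2 - q.2.
have -> : p.1 - q.1 = u1 + v1 by rewrite /u1 /v1; ring.
have -> : p.2 - q.2 = u2 + v2 by rewrite /u2 /v2; ring.
have cs : u1 * v1 + u2 * v2 <= edist p x * edist x q.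
  have m0 : 0 <= edist p x * edist x q by exact: mulr_ge0.
  apply: le_trans (ler_norm _) _.
  rewrite -ler_sqr ?nnegrE // real_normK ?num_real // exprMn !sqr_edist.
  rewrite -/u1 -/u2 -/v1 -/v2 -subr_ge0.
  have -> : (u1 ^+ 2 + u2 ^+ 2) * (v1 ^+ 2 + v2 ^+ 2) -
    (u1 * v1 + u2 * v2) ^+ 2 = (u1 * v2 - u2 * v1) ^+ 2 by ring.
  exact: sqr_ge0.
rewrite -mulr_natl; lra.
Qed.

Lemma edist_axis (u v : R) : edist (u, 0) (v, 0) = `|u - v|.
Proof. by rewrite /edist /= subrr expr0n addr0 sqrtr_sqr. Qed.

Lemma edist_dilate c p t :
  edist (c.1 + t * (p.1 - c.1), c.2 + t * (p.2 - c.2)) c = `|t| * edist p c.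
Proof.
rewrite /edist /= -sqrtr_sqr -sqrtrM ?sqr_ge0 //; congr Num.sqrt; ring.
Qed.

Lemma interior_box (A : set (R * R)) p :
  (A° p)%classic <-> exists2 e, 0 < e &
    forall q, `|p.1 - q.1| < e -> `|p.2 - q.2| < e -> A q.
Proof.
split.
  move=> /nbhs_ballP [e /= e0 eA]; exists e => // q q1 q2.
  by apply: eA; split.
move=> [e e0 eA]; apply/nbhs_ballP; exists e => //= q [q1 q2].
exact: eA.
Qed.

Lemma open_disk_sub_interior c s p :
  edist p c < s -> ((disk c s)° p)%classic.
Proof.
move=> ps; apply/interior_box; exists ((s - edist p c) / 2).
  by rewrite divr_gt0 // subr_gt0.
move=> q q1 q2; rewrite /disk /=.
apply: le_trans (edist_triangle p q c) _.
suff : edist q p <= s - edist p c by lra.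
apply: edist_le; first by rewrite subr_ge0 ltW.
set u := q.1 - p.1; set v := q.2 - p.2.
rewrite -(real_normK (num_real u)) -(real_normK (num_real v)).
have : `|u| < (s - edist p c) / 2 by rewrite /u distrC.
have : `|v| < (s - edist p c) / 2 by rewrite /v distrC.
have := normr_ge0 u; have := normr_ge0 v; nra.
Qed.

(** Were an interior point at distance at least the radius, moving it slightly
further away from the centre would leave the disk. *)
Lemma interior_disk_lt c s p : ((disk c s)° p)%classic -> edist p c < s.
Proof.
move=> /interior_box [e e0 eA].
have [pc|] := leP (edist p c) 0.
  have {}pc := edist_le0 pc; subst c.
  have : disk p s (p.1 + e / 2, p.2).
    apply: eA; rewrite /= ?subrr ?normr0 //.
    by rewrite (_ : _ - _ = - (e / 2)); [rewrite normrN gtr0_norm; lra|ring].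
  rewrite /disk /edist /= !subrr expr0n addr0 => h.
  rewrite add0r sqrtr0; apply: lt_le_trans h.
  by rewrite addrAC subrr add0r sqrtr_sqr gtr0_norm divr_gt0.
move=> pc.
(* moving p by e / 2 along the ray from c keeps it in the box of size e *)
pose t := e / (2 * edist p c).
have t0 : 0 < t by rewrite divr_gt0 // mulr_gt0.
pose q : R * R := (c.1 + (1 + t) * (p.1 - c.1), c.2 + (1 + t) * (p.2 - c.2)).
have tE : t * edist p c = e / 2 by rewrite /t; field; rewrite gt_eqF.
have in_box (x : R) : x ^+ 2 <= edist p c ^+ 2 -> `|- (t * x)| < e.
  rewrite -[x ^+ 2]real_normK ?num_real // ler_sqr ?nnegrE ?normr_ge0 ?edist_ge0 //.
  move=> xp; rewrite normrN normrM (gtr0_norm t0).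
  apply: le_lt_trans (_ : t * edist p c < e); last by lra.
  by rewrite ler_pM2l.
have : disk c s q.
  have s1 := sqr_ge0 (p.1 - c.1); have s2 := sqr_ge0 (p.2 - c.2).
  apply: eA; rewrite /q /=.
    rewrite (_ : _ - _ = - (t * (p.1 - c.1))); last by ring.
    by apply: in_box => //; rewrite sqr_edist; lra.
  rewrite (_ : _ - _ = - (t * (p.2 - c.2))); last by ring.
  by apply: in_box => //; rewrite sqr_edist; lra.
rewrite /disk /= edist_dilate gtr0_norm; nra.
Qed.

Lemma disk_subP c s t : 0 <= s ->
  (disk c s `<=` disk (0, 0) t)%classic <-> edist c (0, 0) + s <= t.
Proof.
move=> s0; split=> [sub|le_t p]; last first.
  rewrite /disk /= => ps; have := edist_triangle c p (0, 0); lra.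
have [c0|c0] := leP (edist c (0, 0)) 0.
  have {}c0 := edist_le0 c0; subst c; have := sub (s, 0).
  by rewrite /disk /= !edist_axis !subr0 normr0 add0r ger0_norm //; apply.
(* the point of the disk furthest from the origin is (1 + k) * c *)
pose k := s / edist c (0, 0).
have k0 : 0 <= k by rewrite divr_ge0 // edist_ge0.
have kE : k * edist c (0, 0) = s by rewrite /k divfK ?gt_eqF.
pose q : R * R := ((1 + k) * c.1, (1 + k) * c.2).
have q0 : edist q (0, 0) = (1 + k) * edist c (0, 0).
  rewrite -[X in X * _]ger0_norm; last by lra.
  by rewrite -edist_dilate /= !subr0 !add0r.
have qc : edist q c = s.
  rewrite -kE -[X in X * _]ger0_norm // /edist /q /= -sqrtr_sqr -sqrtrM ?sqr_ge0 //.
  by congr Num.sqrt; ring.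
have := sub q; rewrite /disk /= qc q0 => /(_ (lexx _)); lra.
Qed.

Lemma disk_disjointP c1 c2 s1 s2 : 0 < s1 -> 0 < s2 ->
  ((disk c1 s1)° `&` (disk c2 s2)° = set0)%classic <->
  s1 + s2 <= edist c1 c2.
Proof.
move=> s10 s20; split=> [dis|le_d]; last first.
  apply/seteqP; split=> // p [/interior_disk_lt p1 /interior_disk_lt p2].
  have := edist_triangle p c1 c2; rewrite [edist c1 p]edistC /=; lra.
rewrite leNgt; apply/negP => lt_d.
(* the point dividing the segment [c1, c2] in the ratio s1 : s2 *)
pose k := s1 / (s1 + s2).
have ss : 0 < s1 + s2 by lra.
have kE : k * (s1 + s2) = s1 by rewrite /k divfK ?gt_eqF.
have k0 : 0 < k by rewrite divr_gt0.
pose p : R * R := (c1.1 + k * (c2.1 - c1.1), c1.2 + k * (c2.2 - c1.2)).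
have d0 := edist_ge0 c1 c2.
have p1 : edist p c1 < s1.
  by rewrite edist_dilate gtr0_norm // edistC -[ltRHS]kE ltr_pM2l.
have k1 : 0 < 1 - k by nra.
have p2 : edist p c2 < s2.
  have -> : p = (c2.1 + (1 - k) * (c1.1 - c2.1), c2.2 + (1 - k) * (c1.2 - c2.2)).
    by rewrite /p; congr pair; ring.
  rewrite edist_dilate gtr0_norm //.
  have -> : s2 = (1 - k) * (s1 + s2) by rewrite mulrBl kE; ring.
  by rewrite ltr_pM2l.
suff : (set0 p)%classic by [].
by rewrite -dis; split; apply: open_disk_sub_interior.
Qed.

End Euclid.

(** * Three disks of which two span the diameter *)

(** A disk of radius [d] touching both disks and the enclosing circle has the
centre given below; a smaller disk fits at the same place. *)
Lemma exists_third_center (R : realType) (x y z : R) : 0 < x -> 0 < y -> 0 < z ->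
  (x ^+ 2 + x * y + y ^+ 2) * z <= x * y * (x + y) ->
  exists p : R * R, [/\ edist p (0, 0) + z <= x + y,
    x + z <= edist (- y, 0) p & y + z <= edist (x, 0) p].
Proof.
move=> x0 y0 z0 zxy; pose q := x ^+ 2 + x * y + y ^+ 2.
have q0 : 0 < q by rewrite /q; nra.
pose d := x * y * (x + y) / q.
have zd : z <= d by rewrite /d ler_pdivlMr // mulrC.
have q_neq0 : q != 0 by rewrite gt_eqF.
have dE : d * q = x * y * (x + y) by rewrite /d divfK.
have dxy : d <= x + y.
  rewrite /d ler_pdivrMr // [leRHS]mulrC ler_wpM2r ?addr_ge0 ?ltW // /q; nra.
exists ((x + y) * (x ^+ 2 - y ^+ 2) / q, 2 * d); split.
- apply: le_trans (_ : (x + y - d) + d <= _); last by rewrite subrK.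
  apply: lerD => //; apply: edist_le; first by rewrite subr_ge0.
  rewrite /= le_eqVlt; apply/orP; left; apply/eqP.
  rewrite /d /q; field; exact: q_neq0.
- apply: le_trans (_ : x + d <= _); first by rewrite lerD2l.
  apply: le_edist; first by lra.
  rewrite /= le_eqVlt; apply/orP; left; apply/eqP.
  rewrite /d /q; field; exact: q_neq0.
- apply: le_trans (_ : y + d <= _); first by rewrite lerD2l.
  apply: le_edist; first by lra.
  rewrite /= le_eqVlt; apply/orP; left; apply/eqP.
  rewrite /d /q; field; exact: q_neq0.
Qed.

(** Disks of radii [x] and [y] in a disk of radius [x + y] lie along a diameter,
with the origin dividing the segment of their centres in the ratio y : x.
Stewart's theorem then expresses the distance of [c] from the origin through
its distances from [p] and [q], which the packing bounds from below. *)
Lemma tight_third_disk (R : realType) (x y z : R) (p q c : R * R) :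
  0 < x -> 0 < y -> 0 < z ->
  edist p (0, 0) <= y -> edist q (0, 0) <= x ->
  edist c (0, 0) + z <= x + y ->
  x + y <= edist p q -> x + z <= edist p c -> y + z <= edist q c ->
  (x ^+ 2 + x * y + y ^+ 2) * z <= x * y * (x + y).
Proof.
move=> x0 y0 z0 py qx cz pq pc qc.
have p0 := edist_ge0 p (0, 0); have q0 := edist_ge0 q (0, 0).
have c0 := edist_ge0 c (0, 0).
have {}py : edist p (0, 0) ^+ 2 <= y ^+ 2 by nra.
have {}qx : edist q (0, 0) ^+ 2 <= x ^+ 2 by nra.
have {}cz : edist c (0, 0) ^+ 2 <= (x + y - z) ^+ 2 by nra.
have {}pq : (x + y) ^+ 2 <= edist p q ^+ 2 by nra.
have {}pc : (x + z) ^+ 2 <= edist p c ^+ 2 by nra.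
have {}qc : (y + z) ^+ 2 <= edist q c ^+ 2 by nra.
move: py qx cz pq pc qc; rewrite !sqr_edist /= !subr0.
case: p q c {p0 q0 c0} => [p1 p2] [q1 q2] [c1 c2] /= py qx cz pq pc qc.
(* the origin is forced to be the barycentre of the centres p and q *)
have bary : (x * p1 + y * q1) ^+ 2 + (x * p2 + y * q2) ^+ 2 <= 0.
  have -> : (x * p1 + y * q1) ^+ 2 + (x * p2 + y * q2) ^+ 2 =
    x * (x + y) * (p1 ^+ 2 + p2 ^+ 2) + y * (x + y) * (q1 ^+ 2 + q2 ^+ 2)
    - x * y * ((p1 - q1) ^+ 2 + (p2 - q2) ^+ 2) by ring.
  have : x * (x + y) * (p1 ^+ 2 + p2 ^+ 2) <= x * (x + y) * y ^+ 2.
    by rewrite ler_pM2l // mulr_gt0 // addr_gt0.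
  have : y * (x + y) * (q1 ^+ 2 + q2 ^+ 2) <= y * (x + y) * x ^+ 2.
    by rewrite ler_pM2l // mulr_gt0 // addr_gt0.
  have : x * y * (x + y) ^+ 2 <= x * y * ((p1 - q1) ^+ 2 + (p2 - q2) ^+ 2).
    by rewrite ler_pM2l // mulr_gt0.
  lra.
have s1 := sqr_ge0 (x * p1 + y * q1); have s2 := sqr_ge0 (x * p2 + y * q2).
have b1 : x * p1 + y * q1 = 0 by apply/eqP; rewrite -sqrf_eq0; apply/eqP; lra.
have b2 : x * p2 + y * q2 = 0 by apply/eqP; rewrite -sqrf_eq0; apply/eqP; lra.
have stewart : x * ((p1 - c1) ^+ 2 + (p2 - c2) ^+ 2)
    + y * ((q1 - c1) ^+ 2 + (q2 - c2) ^+ 2) =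
    (x + y) * (c1 ^+ 2 + c2 ^+ 2) + x * (p1 ^+ 2 + p2 ^+ 2)
    + y * (q1 ^+ 2 + q2 ^+ 2).
  transitivity ((x + y) * (c1 ^+ 2 + c2 ^+ 2) + x * (p1 ^+ 2 + p2 ^+ 2)
    + y * (q1 ^+ 2 + q2 ^+ 2)
    - 2 * c1 * (x * p1 + y * q1) - 2 * c2 * (x * p2 + y * q2)); first by ring.
  by rewrite b1 b2; ring.
have xpc : x * (x + z) ^+ 2 <= x * ((p1 - c1) ^+ 2 + (p2 - c2) ^+ 2).
  by rewrite ler_pM2l.
have yqc : y * (y + z) ^+ 2 <= y * ((q1 - c1) ^+ 2 + (q2 - c2) ^+ 2).
  by rewrite ler_pM2l.
have xp : x * (p1 ^+ 2 + p2 ^+ 2) <= x * y ^+ 2 by rewrite ler_pM2l.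
have yq : y * (q1 ^+ 2 + q2 ^+ 2) <= y * x ^+ 2 by rewrite ler_pM2l.
have xc : (x + y) * (c1 ^+ 2 + c2 ^+ 2) <= (x + y) * (x + y - z) ^+ 2.
  by rewrite ler_pM2l // addr_gt0.
suff : 4 * ((x ^+ 2 + x * y + y ^+ 2) * z) <= 4 * (x * y * (x + y)).
  by rewrite ler_pM2l.
lra.
Qed.

(** * Packings of disks in a disk *)

Section Packing.
Variables (R : realType) (n : nat) (r : 'I_n -> R).
Hypothesis r_gt0 : forall i, 0 < r i.
Implicit Types (A B : {set 'I_n}) (s : R) (i j k a b c d : 'I_n).

Lemma packableP A s :
  packable r A s <-> exists ctr : 'I_n -> R * R,
    (forall i, i \in A -> edist (ctr i) (0, 0) + r i <= s) /\
    (forall i j, i \in A -> j \in A -> i != j ->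
       r i + r j <= edist (ctr i) (ctr j)).
Proof.
split=> -[ctr [inA sep]]; exists ctr; split=> [i iA|i j iA jA ij].
- exact/(disk_subP _ _ (ltW (r_gt0 i)))/inA.
- exact/(disk_disjointP _ _ (r_gt0 i) (r_gt0 j))/sep.
- exact/(disk_subP _ _ (ltW (r_gt0 i)))/inA.
- exact/(disk_disjointP _ _ (r_gt0 i) (r_gt0 j))/sep.
Qed.

(** Each ring takes the place of a ring at least as large. *)
Lemma packable_inj A B s (h : 'I_n -> 'I_n) :
  {in A &, injective h} -> (forall i, i \in A -> h i \in B /\ r i <= r (h i)) ->
  packable r B s -> packable r A s.
Proof.
move=> inj le_h /packableP[ctr [inB sep]]; apply/packableP.
exists (ctr \o h); split=> [i iA|i j iA jA ij] /=.
  by have [/inB + ri] := le_h i iA; lra.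
have [hiB ri] := le_h i iA; have [hjB rj] := le_h j jA.
have hij : h i != h j by apply: contra_neq ij; exact: inj.
by have := sep _ _ hiB hjB hij; lra.
Qed.

Lemma packable_subset A B s :
  A \subset B -> packable r B s -> packable r A s.
Proof.
by move=> /fintype.subsetP sAB; apply: (@packable_inj A B s id) => // i /sAB.
Qed.

Lemma packable2_le a b c d s :
  a != b -> c != d -> r c <= r a -> r d <= r b ->
  packable r [set a; b]%SET s -> packable r [set c; d]%SET s.
Proof.
move=> ab cd ca db; have dc : d != c by rewrite eq_sym.
apply: (@packable_inj _ _ _ (fun k => if k == c then a else b)).
  move=> x y; rewrite !inE => /orP[] /eqP-> /orP[] /eqP->;
    rewrite ?eqxx // (negPf dc) => /eqP; first by rewrite (negPf ab).
  by rewrite eq_sym (negPf ab).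
move=> k; rewrite !inE => /orP[] /eqP->; rewrite ?eqxx ?orbT //.
by rewrite (negPf dc) eqxx orbT.
Qed.

Lemma packable_exchange A s i j : j \notin A -> r i <= r j ->
  packable r (j |: A)%SET s -> packable r (i |: A)%SET s.
Proof.
move=> jA rij; apply: (@packable_inj _ _ _ (fun k => if k == i then j else k)).
  move=> x y; rewrite !inE.
  have [-> _|xi /= xA] := eqVneq x i; have [-> _|yi /= yA] := eqVneq y i => //.
    by move=> jy; rewrite jy yA in jA.
  by move=> xj; rewrite -xj xA in jA.
move=> k; rewrite !inE; have [-> _|ki /= kA] := eqVneq k i.
  by rewrite eqxx.
by rewrite kA orbT.
Qed.

Lemma packable0 s : packable r finset.set0 s.
Proof. by apply/packableP; exists (fun=> (0, 0)); split=> i; rewrite inE. Qed.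

Lemma packable1 i s : packable r [set i]%SET s <-> r i <= s.
Proof.
have e0 : edist (0, 0) (0, 0) = 0 :> R by rewrite edist_axis subrr normr0.
split=> [/packableP[ctr [/(_ i (set11 i)) + _]]|ris].
  by have := edist_ge0 (ctr i) (0, 0); lra.
apply/packableP; exists (fun=> (0, 0)); split=> [j|j k].
  by rewrite inE e0 add0r => /eqP->.
by rewrite !inE => /eqP-> /eqP->; rewrite eqxx.
Qed.

Lemma packable_le A s i : i \in A -> packable r A s -> r i <= s.
Proof.
by move=> iA pA; apply/packable1; apply: packable_subset pA; rewrite finset.sub1set.
Qed.

Lemma packable_pair_le i j s : i != j ->
  packable r [set i; j]%SET s -> r i + r j <= s.
Proof.
move=> ij /packableP[ctr [ins /(_ i j)]].
have := ins i; have := ins j; rewrite !inE !eqxx orbT => /(_ isT) hj /(_ isT) hi.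
move=> /(_ isT isT ij); have := edist_triangle (0, 0) (ctr i) (ctr j).
rewrite [edist (0, 0) _]edistC; lra.
Qed.

Lemma packable_pair i j s : i != j -> r i + r j <= s ->
  packable r [set i; j]%SET s.
Proof.
move=> ij ijs; have ri := r_gt0 i; have rj := r_gt0 j.
have ji : j != i by rewrite eq_sym.
have ej : edist (- r j, 0) (0, 0) = r j by rewrite edist_axis subr0 normrN gtr0_norm.
have ei : edist (r i, 0) (0, 0) = r i by rewrite edist_axis subr0 gtr0_norm.
have eij : r i + r j <= edist (- r j, 0) (r i, 0).
  by rewrite edist_axis -opprD normrN addrC ler_norm.
apply/packableP; exists (fun k => if k == i then (- r j, 0) else (r i, 0)).
split=> [k|k l]; first by rewrite !inE => /orP[] /eqP->; rewrite ?eqxx ?(negPf ji); lra.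
rewrite !inE => /orP[] /eqP-> /orP[] /eqP->; rewrite ?eqxx ?(negPf ji) // => _.
by rewrite addrC edistC.
Qed.

Lemma packable_triple_of_centers a b c s (p q x : R * R) :
  a != b -> a != c -> b != c ->
  [/\ edist p (0, 0) + r a <= s, edist q (0, 0) + r b <= s
    & edist x (0, 0) + r c <= s] ->
  [/\ r a + r b <= edist p q, r a + r c <= edist p x
    & r b + r c <= edist q x] ->
  packable r [set a; b; c]%SET s.
Proof.
move=> ab ac bc [ps qs xs] [pq px qx]; apply/packableP.
exists (fun k => if k == a then p else if k == b then q else x).
have [ba ca cb] : [/\ b != a, c != a & c != b].
  by split; rewrite eq_sym.
split=> [k|k l].
  rewrite !inE => /orP[/orP[]|] /eqP->.
  - by rewrite eqxx.
  - by rewrite eqxx (negPf ba).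
  - by rewrite (negPf ca) (negPf cb).
rewrite !inE => /orP[/orP[]|] /eqP-> /orP[/orP[]|] /eqP->;
  rewrite ?eqxx ?(negPf ba) ?(negPf ca) ?(negPf cb) // => _.
- by rewrite addrC edistC.
- by rewrite addrC edistC.
- by rewrite addrC edistC.
Qed.

Lemma packable_triple a b c s :
  a != b -> a != c -> b != c -> r a + r b <= s ->
  (r a ^+ 2 + r a * r b + r b ^+ 2) * r c <= r a * r b * (r a + r b) ->
  packable r [set a; b; c]%SET s.
Proof.
move=> ab ac bc abs cab.
have a0 := r_gt0 a; have b0 := r_gt0 b; have c0 := r_gt0 c.
have [p [ps pa pb]] := exists_third_center a0 b0 c0 cab.
apply: (@packable_triple_of_centers a b c s (- r b, 0) (r a, 0) p) => //; split=> //.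
- by rewrite edist_axis subr0 normrN gtr0_norm //; lra.
- by rewrite edist_axis subr0 gtr0_norm //; lra.
- lra.
- by rewrite edist_axis -opprD normrN addrC ler_norm.
Qed.

Lemma packable_tight_triple a b c : a != b -> a != c -> b != c ->
  packable r [set a; b; c]%SET (r a + r b) ->
  (r a ^+ 2 + r a * r b + r b ^+ 2) * r c <= r a * r b * (r a + r b).
Proof.
move=> ab ac bc /packableP[ctr [ins sep]].
have := (ins a, ins b, ins c, sep a b, sep a c, sep b c).
rewrite !inE !eqxx ?orbT ab ac bc => -[[[[[]]]]].
move=> /(_ isT) ina /(_ isT) inb /(_ isT) inc.
move=> /(_ isT isT isT) sab /(_ isT isT isT) sac /(_ isT isT isT) sbc.
apply: (tight_third_disk (r_gt0 a) (r_gt0 b) (r_gt0 c) _ _ inc sab sac sbc); lra.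
Qed.

End Packing.

(** * Exchange arguments against a stuck greedy placement *)

Section Inventory.
Variables (R : realType) (n : nat) (r : 'I_n -> R) (w pan : R).
Hypotheses (inv : inventory r) (w_gt0 : 0 < w).
Implicit Types (S T A : {set 'I_n}) (i j k a b c : 'I_n) (x : option 'I_n).
Local Notation region := (region_radius r w pan).

Lemma radius_gt0 i : 0 < r i. Proof. by case: inv. Qed.

Lemma radius_lt i j : (i < j)%N -> r j < r i.
Proof. by case: inv => _; apply. Qed.

Lemma radius_le i j : (i <= j)%N -> r j <= r i.
Proof. by rewrite leq_eqVlt => /orP[/eqP/val_inj->|/radius_lt/ltW]. Qed.

Lemma radius_ltE i j : r j < r i -> (i < j)%N.
Proof.
by move=> rji; rewrite ltnNge leq_eqVlt; apply/negP => /orP[/eqP/val_inj ji|/radius_lt rij];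
  [rewrite ji ltxx in rji|have := lt_trans rij rji; rewrite ltxx].
Qed.

Lemma fits_hole i j : r i <= region (Some j) <-> r i <= r j - w.
Proof. by rewrite /= le_max lt_geF ?radius_gt0. Qed.

Lemma placement_parent S (g : 'I_n -> option 'I_n) i j :
  placement r w pan S g -> i \in S -> g i = Some j ->
  [/\ j \in S, (j < i)%N & r i <= r j - w].
Proof.
move=> [up _] iS gi; have [jS rij] := up _ _ iS gi; split=> //.
by apply: radius_ltE; move: w_gt0 rij; lra.
Qed.

(** The situation at the first difference: the greedy parents [g] place [T],
no container admits the smaller ring [i], but [q] places [i |: T]. *)
Section Stuck.
Variables (T : {set 'I_n}) (i : 'I_n) (g q : 'I_n -> option 'I_n).
Hypothesis below : forall k, k \in T -> (k < i)%N.
Hypothesis g_place : placement r w pan T g.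
Hypothesis q_place : placement r w pan (i |: T)%SET q.
Hypothesis stuck : forall x, (if x is Some j then j \in T else true) ->
  ~ packable r (i |: [set k in T | g k == x])%SET (region x).

Lemma below_in k : k \in (i |: T)%SET -> (k <= i)%N.
Proof. by rewrite !inE => /orP[/eqP->//|/below/ltnW]. Qed.

Lemma optimal_parent k j : k \in (i |: T)%SET -> q k = Some j ->
  [/\ j \in T, (j < k)%N & r k <= r j - w].
Proof.
move=> kT qk; have [jT jk rkj] := placement_parent q_place kT qk; split=> //.
move: jT; rewrite !inE => /orP[/eqP ji|//].
by have := below_in kT; rewrite -ji leqNgt jk.
Qed.

(** A hole that is empty under [g] does not admit [i], so it is smaller than
[i] and than every ring above [i]. *)
Lemma optimal_avoids_childless j k : j \in T ->
  (forall l, l \in T -> g l <> Some j) -> k \in (i |: T)%SET -> q k <> Some j.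
Proof.
move=> jT childless kT qk; have [_ _ rkj] := optimal_parent kT qk.
apply: (stuck (x := Some j)) => //.
rewrite (_ : [set _ in _ | _]%SET = finset.set0) ?finset.setU0; last first.
  by apply/finset.setP => l; rewrite !inE; apply/negP => /andP[/childless + /eqP].
apply/(packable1 radius_gt0)/fits_hole.
suff : r i <= r k by lra.
exact/radius_le/below_in.
Qed.

Lemma optimal_packable x A :
  (forall k, k \in A -> k \in (i |: T)%SET /\ q k = x) ->
  packable r A (region x).
Proof.
move=> Ax; have [_ /(_ x)] := q_place; apply: (packable_subset radius_gt0).
by apply/fintype.subsetP => k /Ax[kT qk]; rewrite finset.inE kT qk eqxx.
Qed.

Lemma stuck_superset x A : (if x is Some j then j \in T else true) ->
  (forall k, k \in T -> g k = x -> k \in A) ->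
  ~ packable r (i |: A)%SET (region x).
Proof.
move=> xT sub pA; apply: (stuck xT); apply: packable_subset pA => //.
  exact: radius_gt0.
apply: finset.setUS; apply/fintype.subsetP => k.
by rewrite finset.inE => /andP[kT /eqP]; exact: sub.
Qed.


Lemma optimal_top k : k \in (i |: T)%SET ->
  (forall j, j \in T -> (k <= j)%N) -> q k = None.
Proof.
move=> kT top; case qk : (q k) => [j|] //.
by have [/top + jk _] := optimal_parent kT qk; rewrite leqNgt jk.
Qed.

(** Otherwise the pan would hold [i] beside all of [T], whatever part of [T] it
holds under [g]. *)
Lemma not_all_in_pan : ~ (forall k, k \in (i |: T)%SET -> q k = None).
Proof.
move=> all_pan; apply: (stuck_superset (x := None) (A := T)) => //.
by apply: (optimal_packable (x := None)) => k kT; split=> //; exact: all_pan.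
Qed.

Lemma optimal_pair x k l : k \in (i |: T)%SET -> l \in (i |: T)%SET ->
  q k = x -> q l = x -> packable r [set k; l]%SET (region x).
Proof.
by move=> kT lT qk ql; apply: optimal_packable => m; rewrite inE => /orP[]; rewrite inE => /eqP->.
Qed.

(** If [l] and [m] were together in [x], then [k] could take the place of [l],
and [i] that of [m], although [x] with its single ring [k] refuses [i]. *)
Lemma optimal_no_company x k l m : (if x is Some j then j \in T else true) ->
  (forall e, e \in T -> g e = x -> e = k) ->
  l \in (i |: T)%SET -> m \in (i |: T)%SET -> (l <= k)%N -> k \in T -> l != m ->
  q l = x -> q m <> x.
Proof.
move=> xT lone lT mT lk kT lm ql qm.
apply: (stuck_superset (A := [set k]%SET) xT) => [e eT /(lone e eT)->|]; first by rewrite inE.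
have ik : k != i by rewrite -val_eqE neq_ltn below.
rewrite finset.setUC.
apply: (packable2_le radius_gt0 lm ik _ _ (optimal_pair lT mT ql qm)); apply: radius_le => //; exact: below_in.
Qed.

Lemma stuck_nonempty : T <> finset.set0.
Proof.
move=> T0.
have iT : i \in (i |: T)%SET by rewrite !inE eqxx.
have qi : q i = None by apply: optimal_top => // j; rewrite T0 inE.
apply: (stuck_superset (x := None) (A := finset.set0)) => //.
  by move=> k; rewrite T0.
apply: (optimal_packable (x := None)) => k.
by rewrite finset.setU0 inE => /eqP->.
Qed.

Lemma stuck_not_singleton a : T <> [set a]%SET.
Proof.
move=> T1.
have iT : i \in (i |: T)%SET by rewrite !inE eqxx.
have aT : a \in T by rewrite T1 inE.
have aiT : a \in (i |: T)%SET by rewrite inE aT orbT.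
have ga : g a = None.
  case gak : (g a) => [j|] //; have [] := placement_parent g_place aT gak.
  by rewrite T1 inE => /eqP->; rewrite ltnn.
have qa : q a = None by apply: optimal_top => // j; rewrite T1 inE => /eqP->.
have avoid k : k \in (i |: T)%SET -> q k <> Some a.
  by apply: optimal_avoids_childless => // l; rewrite T1 inE => /eqP->; rewrite ga.
have qi : q i = None.
  case qi : (q i) => [j|] //; have [jT _ _] := optimal_parent iT qi.
  by move: jT qi; rewrite T1 inE => /eqP-> /(avoid _ iT).
apply: not_all_in_pan => k; rewrite T1 !inE => /orP[] /eqP-> //.
Qed.


Lemma stuck_not_pair a b : (a < b)%N -> T <> [set a; b]%SET.
Proof.
move=> ab T2.
have inT k : (k \in T) = (k == a) || (k == b) by rewrite T2 !inE.
have iT : i \in (i |: T)%SET by rewrite !inE eqxx.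
have aT : a \in T by rewrite inT eqxx.
have bT : b \in T by rewrite inT eqxx orbT.
have sT k : k \in T -> k \in (i |: T)%SET by rewrite [in X in _ -> X]inE orbC => ->.
have anb : a != b by rewrite -val_eqE neq_ltn ab.
have ai : a != i by rewrite -val_eqE neq_ltn below.
have bi : b != i by rewrite -val_eqE neq_ltn below.
have ga : g a = None.
  case gak : (g a) => [j|] //; have [] := placement_parent g_place aT gak.
  by rewrite inT => /orP[] /eqP->; rewrite ?ltnn // ltnNge ltnW.
have qa : q a = None.
  by apply: optimal_top => [|j]; [exact: sT|rewrite inT => /orP[] /eqP-> //; exact: ltnW].
have avoid_b k : g b = Some a \/ g b = None -> k \in (i |: T)%SET -> q k <> Some b.
  move=> gb; apply: optimal_avoids_childless => // l.
  by rewrite inT => /orP[] /eqP->; [rewrite ga|case: gb => -> // -[h]; rewrite h ltnn in ab].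
case gb : (g b) => [j|].
  have [] := placement_parent g_place bT gb; rewrite inT => /orP[] /eqP jE;
    rewrite jE ?ltnn // in gb * => _ _.
  have notP m : m \in (i |: T)%SET -> a != m -> q m <> None.
    move=> mT am; apply: (optimal_no_company (x := None) (k := a) (l := a)) => //; last exact: sT.
    by move=> e; rewrite inT => /orP[] /eqP-> //; rewrite gb.
  have inA m : m \in (i |: T)%SET -> a != m -> q m = Some a.
    move=> mT am; case qm : (q m) => [l|]; last by case: (notP m).
    have [] := optimal_parent mT qm; rewrite inT => /orP[] /eqP lE; rewrite lE // in qm *.
    by case: (avoid_b m) => //; left.
  apply: (optimal_no_company (x := Some a) (k := b) (l := b) (m := i)) => //; try exact: sT; try exact: inA.
  - by move=> e; rewrite inT => /orP[] /eqP-> //; rewrite ga.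
  - by apply: inA => //; exact: sT.
apply: not_all_in_pan => k kT; case qk : (q k) => [j|] //.
have [jT _ _] := optimal_parent kT qk.
case: (optimal_avoids_childless jT _ kT qk) => l.
by rewrite inT => /orP[] /eqP->; rewrite ?ga ?gb.
Qed.

(** If [g] has [b] in the pan and [c] elsewhere, both claims are read off from
[g].  If [g] has [c] but not [b] in the pan, then [a], [c], [i] do not fit in
the pan, so [a], [b], [i] do not either; and [b] must be in the pan under [q],
as otherwise it would be alone in the hole of [a], which would leave all
the others to the pan.  The remaining three cases are contradictory. *)
Lemma stuck_triple a b c : (a < b)%N -> (b < c)%N -> T = [set a; b; c]%SET ->
  packable r [set a; b]%SET pan /\ ~ packable r [set a; b; i]%SET pan.
Proof.
move=> ab bc T3; have ac := ltn_trans ab bc.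
have inT k : (k \in T) = [|| k == a, k == b | k == c] by rewrite T3 !inE orbA.
have iT : i \in (i |: T)%SET by rewrite !inE eqxx.
have aT : a \in T by rewrite inT eqxx.
have bT : b \in T by rewrite inT eqxx orbT.
have cT : c \in T by rewrite inT eqxx !orbT.
have sT k : k \in T -> k \in (i |: T)%SET by rewrite [in X in _ -> X]inE orbC => ->.
have [anb anc bnc] : [/\ a != b, a != c & b != c].
  by rewrite -!val_eqE !neq_ltn ab ac bc.
have [ani bni cni] : [/\ a != i, b != i & c != i].
  by rewrite -!val_eqE !neq_ltn !below.
have forT (P : 'I_n -> Prop) : P a -> P b -> P c -> forall k, k \in T -> P k.
  by move=> Pa Pb Pc k; rewrite inT => /or3P[] /eqP->.
have ga : g a = None.
  case gak : (g a) => [j|] //; have [] := placement_parent g_place aT gak.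
  by rewrite inT => /or3P[] /eqP->; rewrite ?ltnn // ltnNge ltnW.
have qa : q a = None.
  by apply: optimal_top; [exact: sT|apply: forT => //; exact: ltnW].
have g_lt k j : k \in T -> g k = Some j -> (j < k)%N.
  by move=> kT gk; have [] := placement_parent g_place kT gk.
have avoid_c k : k \in (i |: T)%SET -> q k <> Some c.
  apply: optimal_avoids_childless => //; apply: forT => gk.
  - by rewrite ga in gk.
  - by have := g_lt b c bT gk; rewrite ltnNge ltnW.
  - by have := g_lt c c cT gk; rewrite ltnn.
have gbE : g b = None \/ g b = Some a.
  case gb : (g b) => [j|]; [right|by left].
  have [] := placement_parent g_place bT gb; rewrite inT => /or3P[] /eqP -> //.
    by rewrite ltnn.
  by rewrite ltnNge ltnW.
have gcE : [\/ g c = None, g c = Some a | g c = Some b].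
  case gc : (g c) => [j|]; last by constructor 1.
  have [] := placement_parent g_place cT gc; rewrite inT => /or3P[] /eqP ->.
  - by constructor 2.
  - by constructor 3.
  - by rewrite ltnn.
have qE k : k \in (i |: T)%SET -> [\/ q k = None, q k = Some a | q k = Some b].
  move=> kT; case qk : (q k) => [j|]; last by constructor 1.
  have [] := optimal_parent kT qk; rewrite inT => /or3P[] /eqP jE _ _; rewrite jE in qk *.
  - by constructor 2.
  - by constructor 3.
  - by case: (avoid_c k kT).
have avoid_b k : g c <> Some b -> k \in (i |: T)%SET -> q k <> Some b.
  move=> gcb; apply: optimal_avoids_childless => //; apply: forT => //.
    by rewrite ga.
  by move=> /(g_lt b b bT); rewrite ltnn.
have pan_pair : g b = None -> packable r [set a; b]%SET pan.
  move=> gb; have [_ /(_ None)] := g_place; apply: packable_subset; first exact: radius_gt0.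
  by apply/fintype.subsetP => k; rewrite !inE inT => /orP[] /eqP->; rewrite ?ga ?gb ?eqxx ?orbT.
have abiE : [set a; b; i]%SET = (i |: [set a; b])%SET by rewrite finset.setUC.
case: gbE => gb; case: gcE => gc.
(* b and c in the pan: no hole is occupied under g, hence none under q *)
- case: not_all_in_pan => k kT; case: (qE k kT) => // qk.
  + exfalso; apply: (optimal_avoids_childless aT _ kT qk).
    by apply: forT; rewrite ?ga ?gb ?gc.
  + by case: (avoid_b k _ kT qk); rewrite gc.
- split; first exact: pan_pair.
  rewrite abiE; apply: (stuck_superset (x := None)) => //.
  by apply: forT; rewrite ?ga ?gb ?gc // !inE eqxx ?orbT.
- split; first exact: pan_pair.
  rewrite abiE; apply: (stuck_superset (x := None)) => //.
  by apply: forT; rewrite ?ga ?gb ?gc // !inE eqxx ?orbT.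
(* b in the hole of a, and c in the pan *)
- have aciN : ~ packable r (i |: [set a; c])%SET pan.
    apply: (stuck_superset (x := None)) => //.
    by apply: forT; rewrite ?ga ?gb ?gc // !inE eqxx ?orbT.
  have qb : q b = None.
    have [//|qb|/avoid_b] := qE b (sT b bT); last by rewrite gc => /(_ _ (sT b bT)); case.
    have notA m : m \in (i |: T)%SET -> b != m -> q m <> Some a.
      move=> mT bm; apply: (optimal_no_company (x := Some a) (k := b) (l := b)) => //; last exact: sT.
      by apply: forT => //; rewrite ?ga ?gc.
    have inP m : m \in (i |: T)%SET -> b != m -> q m = None.
      move=> mT bm; have [//|qm|qm] := qE m mT; first by case: (notA m).
      by case: (avoid_b m); rewrite ?gc.
    case: aciN; apply: (optimal_packable (x := None)) => k.
    rewrite finset.in_setU1 finset.in_set2 => /or3P[] /eqP->.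
    + by split; [|apply: inP].
    + by split; [exact: sT|].
    + by split; [exact: sT|apply: inP => //; exact: sT].
  split; first exact: (optimal_pair (x := None) (sT a aT) (sT b bT)).
  move=> pabi; apply: aciN.
  have -> : (i |: [set a; c])%SET = (c |: [set a; i])%SET.
    by rewrite finset.setUCA [RHS]finset.setUCA (finset.setUC [set i]%SET).
  apply: (packable_exchange radius_gt0 (j := b)).
  + by rewrite !inE negb_or bni eq_sym anb.
  + exact: radius_le (ltnW bc).
  + by rewrite finset.setUA (finset.setUC [set b]%SET).
(* b and c in the hole of a: nothing joins a in the pan, all goes to its hole *)
- exfalso; apply: (stuck_superset (x := Some a) (A := [set b; c]%SET)) => //.
    by apply: forT; rewrite ?ga // !inE eqxx ?orbT.
  have inA m : m \in (i |: T)%SET -> a != m -> q m = Some a.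
    move=> mT am; have [qm|//|qm] := qE m mT.
      case: (optimal_no_company (x := None) (k := a) (l := a) (m := m)) => //; last exact: sT.
      by apply: forT; rewrite ?gb ?gc.
    by case: (avoid_b m); rewrite ?gc //; case=> h; rewrite h eqxx in anb.
  apply: optimal_packable => k; rewrite finset.in_setU1 finset.in_set2 => /or3P[] /eqP->.
  + by split; [|apply: inA].
  + by split; [exact: sT|apply: inA => //; exact: sT].
  + by split; [exact: sT|apply: inA => //; exact: sT].
(* a, b, c nested: q has to nest them in the same way, with i beside c *)
- exfalso.
  have notP m : m \in (i |: T)%SET -> a != m -> q m <> None.
    move=> mT am; apply: (optimal_no_company (x := None) (k := a) (l := a)) => //; last exact: sT.
    by apply: forT; rewrite ?gb ?gc.
  have qb : q b = Some a.
    have [/notP|//|qb] := qE b (sT b bT); first by case=> //; exact: sT.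
    by have [_] := optimal_parent (sT b bT) qb; rewrite ltnn.
  have notA m : m \in (i |: T)%SET -> b != m -> q m <> Some a.
    move=> mT bm; apply: (optimal_no_company (x := Some a) (k := b) (l := b)) => //; last exact: sT.
    by apply: forT; rewrite ?ga ?gc // => -[h]; rewrite h eqxx in anb.
  have inB m : m \in (i |: T)%SET -> a != m -> b != m -> q m = Some b.
    by move=> mT am bm; have [/notP|/notA|//] := qE m mT; case.
  apply: (optimal_no_company (x := Some b) (k := c) (l := c) (m := i)) => //; try exact: sT.
  + by apply: forT; rewrite ?ga ?gb // => -[h]; rewrite h eqxx in anb.
  + by apply: inB => //; exact: sT.
  + exact: inB.
Qed.

End Stuck.
End Inventory.

(** * The first ring on which greedy and lex-max differ *)

Section Greedy.
Variables (R : realType) (n : nat) (r : 'I_n -> R) (w pan : R).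
Implicit Types (S T A : {set 'I_n}) (i j k a b c : 'I_n) (x : option 'I_n).
Local Notation region := (region_radius r w pan).
Local Notation lexmax := (lexmax r w pan).

Let step S i := if `[< feasible r w pan (i |: S)%SET >] then (i |: S)%SET else S.

Lemma foldl_step_mem (s : seq 'I_n) S k :
  k \notin s -> (k \in foldl step S s) = (k \in S).
Proof.
elim: s S => //= l s IH S; rewrite inE negb_or => /andP[kl ks].
rewrite IH // /step; case: ifP => // _.
by rewrite !inE (negPf kl).
Qed.

(** The scan restricted to the rings before [i] has the same outcome below [i]
as the whole scan, since a decision is never revised. *)
Lemma lexmaxP i :
  i \in lexmax <-> feasible r w pan (i |: [set k in lexmax | (k < i)%N])%SET.
Proof.
pose e := enum 'I_n; pose S1 := foldl step finset.set0 (take i e).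
have eE : e = take i e ++ i :: drop i.+1 e.
  rewrite -[LHS](cat_take_drop i) (drop_nth i) ?size_enum_ord //.
  by rewrite nth_ord_enum.
have before k : (k \in take i e) = (k < i)%N.
  rewrite -(mem_map val_inj) map_take val_enum_ord take_iota mem_iota /= add0n.
  by rewrite leq_min ltn_ord andbT.
have after k : (k \in drop i.+1 e) = (i < k)%N.
  rewrite -(mem_map val_inj) map_drop val_enum_ord drop_iota mem_iota /= add0n.
  have := ltn_ord k; have := ltn_ord i; lia.
have lE : lexmax = foldl step (step S1 i) (drop i.+1 e).
  by rewrite /Defs.lexmax -/step -/e [in LHS]eE foldl_cat.
have S1E : [set k in lexmax | (k < i)%N]%SET = S1.
  apply/finset.setP => k; rewrite inE lE.
  have [ki|ik] := ltnP k i.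
    rewrite andbT foldl_step_mem ?after -?leqNgt ?(ltnW ki) //.
    by rewrite /step; case: ifP => // _; rewrite !inE -val_eqE ltn_eqF.
  by rewrite andbF foldl_step_mem ?inE // before -leqNgt.
rewrite S1E [in X in X <-> _]lE foldl_step_mem ?after ?ltnn //.
rewrite /step; case: ifPn => [/asboolP f|/asboolP nf].
  by rewrite !inE eqxx; split.
by rewrite foldl_step_mem ?before ?ltnn // inE; split.
Qed.

Hypotheses (inv : inventory r) (w_gt0 : 0 < w).
Variable f : outcome n.
Hypothesis fgreedy : greedy_execution r w pan f.

(** The content of a container was packable when its last ring was admitted. *)
Lemma greedy_placement (m : nat) :
  placement r w pan [set k : 'I_n | (k < m)%N & f k != None]%SET
    (fun k => odflt None (f k)).
Proof.
have r_gt0 := radius_gt0 inv; split=> [i j|x].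
  rewrite !inE => /andP[im fi] fij.
  have {fi}fi : f i = Some (Some j) by case: (f i) fi fij => //= ? _ ->.
  have := fgreedy i; rewrite fi => -[[ji /eqP fj] pk].
  rewrite fj andbT (ltn_trans ji im); split=> //.
  by apply/(fits_hole w pan inv); apply: (packable_le r_gt0 _ pk); rewrite !inE eqxx.
set A := [set _ in _ | _]%SET.
have [A0|[a0 a0A]] := finset.set_0Vmem A; first by rewrite A0; exact: packable0.
case: (@arg_maxnP _ a0 (mem A) val a0A) => l lA lmax.
have fA k : k \in A -> f k = Some x /\ (k < m)%N.
  rewrite !inE => /andP[/andP[km fk] /eqP <-].
  by case: (f k) fk.
have [flx lm] := fA l lA; have := fgreedy l; rewrite flx => -[_].
apply: packable_subset => //; apply/fintype.subsetP => k kA.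
have [fk _] := fA k kA; rewrite !inE fk eqxx andbT.
have := lmax k kA; rewrite /= leq_eqVlt => /orP[/eqP/val_inj->|->]; last by rewrite orbT.
by rewrite eqxx.
Qed.

Lemma fails_first_skip : fails r w pan f ->
  exists2 i, f i = None &
    feasible r w pan (i |: [set k : 'I_n | (k < i)%N & f k != None])%SET.
Proof.
move=> fl.
pose differ i := (f i != None) != (i \in lexmax).
have [i0 di0] : exists i, differ i.
  apply/existsP; apply: contra_notT fl => /existsPn same.
  apply/finset.setP => i; rewrite inE.
  by have /negPn/eqP := same i.
case: (@arg_minnP _ i0 differ val di0) => i di imin.
have beforeE : [set k in lexmax | (k < i)%N]%SET =
    [set k : 'I_n | (k < i)%N & f k != None]%SET.
  apply/finset.setP => k; rewrite !inE andbC; have [ki|//] := ltnP k i.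
  have : ~~ differ k by apply: contraL ki => /imin; rewrite -leqNgt.
  by rewrite negbK => /eqP->.
have iP := lexmaxP i; rewrite beforeE in iP.
have fi : f i = None.
  case fi : (f i) => [x|] //; move: di; rewrite /differ fi => /negP[].
  apply/eqP/esym/iP; exists (fun k => odflt None (f k)).
  suff -> : (i |: [set k : 'I_n | (k < i)%N & f k != None])%SET =
    [set k : 'I_n | (k < i.+1)%N & f k != None]%SET by exact: greedy_placement.
  apply/finset.setP => k; rewrite !inE ltnS [in RHS]leq_eqVlt.
  by have [->|ki] := eqVneq k i; [rewrite !eqxx fi|rewrite (negPf (ki : val k != val i))].
exists i => //; apply/iP.
by move: di; rewrite /differ fi eqxx; case: (i \in lexmax).
Qed.
End Greedy.

(** * The golden ratio bound *)

Lemma golden_gt0 (R : realType) : 0 < golden R.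
Proof. by rewrite divr_gt0 // addr_gt0 // sqrtr_gt0. Qed.

Lemma golden_sqr (R : realType) : golden R ^+ 2 = golden R + 1.
Proof.
have s5 : Num.sqrt (5 : R) ^+ 2 = 5 by rewrite sqr_sqrtr.
by rewrite /golden; move: s5; set u := Num.sqrt _; lra.
Qed.

(** When [z] and [t] both sit at the lower bound of [t], the two margins are
positive multiples of [s * y - x] and [x - s * y], where [s] is the golden
ratio.  The factorizations hold modulo [s ^+ 2 = s + 1]; the assumptions on
[t] and [z] make the conclusions strict. *)
Lemma ratio_exceeds_golden (R : realType) (x y z t : R) :
  0 < y -> y < x -> 0 < t -> t < z ->
  x * y * (x + y) < (x ^+ 2 + x * y + y ^+ 2) * t ->
  golden R * x < y + z + t \/ golden R * y < z + t.
Proof.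
move=> y0 yx t0 tz big_t; have s2 := golden_sqr R; have s0 := golden_gt0 R.
move: (golden R) s2 s0 => s s2 s0.
have x0 : 0 < x := lt_trans y0 yx.
pose m := x ^+ 2 + x * y + y ^+ 2.
have m0 : 0 < m by rewrite /m; nra.
have [xsy|syx] := leP x (s * y); [left|right].
- suff : m * (s * x) < m * (y + 2 * t) by rewrite ltr_pM2l //; lra.
  have : 0 <= (s * y - x) * (y ^+ 2 + 2 * x * y + s ^+ 2 * x ^+ 2).
    by apply: mulr_ge0; [lra|rewrite s2; nra].
  have -> : (s * y - x) * (y ^+ 2 + 2 * x * y + s ^+ 2 * x ^+ 2) =
     s * (m * (y - s * x) + 2 * (x * y * (x + y))).
    (* the cofactor is the quotient of the difference by s ^+ 2 - s - 1 *)
    rewrite -[RHS]addr0 -(mul0r (x * y ^+ 2 + (s + 2) * x ^+ 2 * y)).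
    have <- : s ^+ 2 - s - 1 = 0 by rewrite s2; ring.
    by rewrite /m; ring.
  rewrite pmulr_rge0 // => h.
  have : m * (s * x) <= m * y + 2 * (x * y * (x + y)) by lra.
  rewrite /m in big_t *; lra.
- suff : m * (s * y) < m * (2 * t) by rewrite ltr_pM2l //; lra.
  have s_lt2 : s < 2 by nra.
  have h : 0 <= y * ((2 - s) * (x - s * y) * (x + (s + 1) * y)).
    apply: mulr_ge0; first exact: ltW.
    by apply: mulr_ge0; [apply: mulr_ge0; lra | nra].
  have h2 : y * ((2 - s) * (x - s * y) * (x + (s + 1) * y)) =
      2 * (x * y * (x + y)) - m * (s * y).
    rewrite -[RHS]addr0 -(mul0r (s * y ^+ 3)).
    have <- : s ^+ 2 - s - 1 = 0 by rewrite s2; ring.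
    by rewrite /m; ring.
  by rewrite h2 in h; rewrite /m in big_t h *; lra.
Qed.

Section LowerBound.
Variables (R : realType) (n : nat) (r : 'I_n -> R).
Hypothesis inv : inventory r.
Implicit Types (T A : {set 'I_n}) (i j k a b c : 'I_n).

Lemma le_rho a A : (forall k, k \in A -> (a < k)%N) ->
  (\sum_(k in A) r k) / r a <= rho r.
Proof.
move=> aA; have r_gt0 := radius_gt0 inv.
apply: le_trans (le_bigmax _ (fun i : 'I_n => (\sum_(j < n | (i < j)%N) r j) / r i) a).
rewrite ler_pM2r ?invr_gt0 // big_mkcond [leRHS]big_mkcond ler_sum // => k _.
case: ifP => [/aA->//|_]; case: ifP => // _; exact: ltW.
Qed.

Lemma set_of_card_le3 T : (#|T| <= 3)%N ->
  [\/ T = finset.set0, exists a, T = [set a]%SET,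
      exists a b, (a < b)%N /\ T = [set a; b]%SET
    | exists a b c, [/\ (a < b)%N, (b < c)%N & T = [set a; b; c]%SET]].
Proof.
have lt_tr : transitive (fun i j : 'I_n => (i < j)%N) by move=> ? ? ?; exact: ltn_trans.
have : sorted (fun i j : 'I_n => (i < j)%N) (enum T).
  rewrite /enum_mem; apply: (sorted_filter lt_tr).
  by rewrite -enumT -(sorted_map (f := val) (e' := ltn)) val_enum_ord iota_ltn_sorted.
have TE k : (k \in T) = (k \in enum T) by rewrite mem_enum.
rewrite cardE; case: (enum T) TE => [|a [|b [|c [|]]]] //= TE.
- by move=> _ _; constructor 1; apply/finset.setP => k; rewrite TE !inE.
- by move=> _ _; constructor 2; exists a; apply/finset.setP => k; rewrite TE !inE.
- move=> /andP[ab _] _; constructor 3; exists a, b; split=> //.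
  by apply/finset.setP => k; rewrite TE !inE.
- move=> /and3P[ab bc _] _; constructor 4; exists a, b, c; split=> //.
  by apply/finset.setP => k; rewrite TE !inE orbA.
Qed.

Variables (w pan : R) (f : outcome n).
Hypotheses (w_gt0 : 0 < w) (fgreedy : greedy_execution r w pan f).

Lemma failure_shape : (n <= 4)%N -> fails r w pan f ->
  exists a b c i, [/\ (a < b)%N, (b < c)%N & (c < i)%N] /\
    packable r [set a; b]%SET pan /\ ~ packable r [set a; b; i]%SET pan.
Proof.
move=> n4 /(fails_first_skip inv fgreedy)[i fi].
set T := [set k : 'I_n | _ & _]%SET => -[q q_place].
have below k : k \in T -> (k < i)%N by rewrite inE => /andP[].
have g_place := greedy_placement inv fgreedy i.
have stuck x : (if x is Some j then j \in T else true) ->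
    ~ packable r (i |: [set k in T | odflt None (f k) == x])%SET (region_radius r w pan x).
  move=> xT pk; have := fgreedy i; rewrite fi => /(_ x); apply; split.
    by case: x xT {pk} => //= j; rewrite inE => /andP[ji /eqP].
  apply: packable_subset pk; first exact: (radius_gt0 inv).
  apply: finset.setUS; apply/fintype.subsetP => k; rewrite !inE => /andP[-> /eqP->].
  by rewrite eqxx.
have T3 : (#|T| <= 3)%N.
  have : (#|T| <= i)%N; last by have := ltn_ord i; lia.
  rewrite -[leqRHS](size_iota 0) cardE -(size_map val).
  apply: uniq_leq_size; first by rewrite (map_inj_uniq val_inj) enum_uniq.
  by move=> m /mapP[k]; rewrite mem_enum mem_iota => /below ? ->.
have [T0|[a Ta]|[a [b [ab Tab]]]|[a [b [c [ab bc Tabc]]]]] := set_of_card_le3 T3.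
- by case: (stuck_nonempty inv w_gt0 below q_place stuck).
- by case: (stuck_not_singleton inv w_gt0 below g_place q_place stuck Ta).
- by case: (stuck_not_pair inv w_gt0 below g_place q_place stuck ab Tab).
- exists a, b, c, i; split; last exact: (stuck_triple inv w_gt0 below g_place q_place stuck ab bc Tabc).
  by split=> //; apply: below; rewrite Tabc !inE eqxx orbT.
Qed.

Lemma golden_lt_rho : (n <= 4)%N -> fails r w pan f -> golden R < rho r.
Proof.
move=> n4 fl; have [a [b [c [i [[ab bc ci] [pab npabi]]]]]] := failure_shape n4 fl.
have r_gt0 := radius_gt0 inv.
have [ac bi ai] : [/\ (a < c)%N, (b < i)%N & (a < i)%N].
  by split; lia.
have [anb ani bni] : [/\ a != b, a != i & b != i].
  by rewrite -!val_eqE !neq_ltn ab ai bi.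
have cni : c != i by rewrite -val_eqE neq_ltn ci.
have bnc : b != c by rewrite -val_eqE neq_ltn bc.
have big_i : r a * r b * (r a + r b) < (r a ^+ 2 + r a * r b + r b ^+ 2) * r i.
  rewrite ltNge; apply/negP => small; apply: npabi.
  exact: packable_triple (packable_pair_le r_gt0 anb pab) small.
have [h|h] := ratio_exceeds_golden (r_gt0 b) (radius_lt inv ab) (r_gt0 i) (radius_lt inv ci) big_i.
- apply: lt_le_trans (le_rho (a := a) (A := [set b; c; i]%SET) _).
    rewrite ltr_pdivlMr // -finset.setUA big_setU1 ?big_setU1 ?big_set1 /= ?inE ?negb_or ?bnc ?bni //.
    by rewrite addrA.
  by move=> k; rewrite !inE => /orP[/orP[]|] /eqP->.
- apply: lt_le_trans (le_rho (a := b) (A := [set c; i]%SET) _).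
    by rewrite ltr_pdivlMr // big_setU1 ?big_set1 ?inE.
  by move=> k; rewrite !inE => /orP[] /eqP->.
Qed.
End LowerBound.

(** * Failing executions with ratio close to the golden ratio *)

Section Family.
Variables (R : realType) (e : R).
Hypotheses (e_gt0 : 0 < e) (e_small : e <= 1 / 100).
Let t : R := golden R - 1.

(** The first two radii are in golden proportion, where the gap they leave in
the pan of radius [1 + t] is 1/2; the other two are just above it. *)
Definition near_golden (i : 'I_4) : R :=
  nth 0 [:: 1; t; 1 / 2 + 2 * e; 1 / 2 + e] i.
Definition near_golden_outcome : outcome 4 := fun i =>
  nth None [:: Some None; Some None; Some (Some ord0); None] i.
Local Notation r := near_golden.
Local Notation f := near_golden_outcome.
(* the hole of the first ring has the radius of the second ring *)
Local Notation w := (1 - t).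
Local Notation pan := (golden R).

Let o0 : 'I_4 := ord0.
Let o1 : 'I_4 := Ordinal (isT : 1 < 4)%N.
Let o2 : 'I_4 := Ordinal (isT : 2 < 4)%N.
Let o3 : 'I_4 := Ordinal (isT : 3 < 4)%N.

Lemma all_ord4 (P : 'I_4 -> Prop) : P o0 -> P o1 -> P o2 -> P o3 -> forall i, P i.
Proof.
move=> P0 P1 P2 P3 [[|[|[|[|m]]]] lt_m] //.
- by rewrite (_ : Ordinal _ = o0) //; apply: val_inj.
- by rewrite (_ : Ordinal _ = o1) //; apply: val_inj.
- by rewrite (_ : Ordinal _ = o2) //; apply: val_inj.
- by rewrite (_ : Ordinal _ = o3) //; apply: val_inj.
Qed.

Lemma inv_golden_sqr : t ^+ 2 = 1 - t.
Proof. by rewrite /t sqrrB expr1n mulr1 golden_sqr; ring. Qed.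

Lemma inv_golden_bounds : 618 / 1000 < t < 619 / 1000.
Proof.
have t2 := inv_golden_sqr; have g1 : 1 < golden R.
  by have := golden_sqr R; have := golden_gt0 R; nra.
have t0 : 0 < t by rewrite subr_gt0.
by move: t t0 t2 => x x0 x2; apply/andP; split; nra.
Qed.

Lemma near_golden_inventory : inventory r.
Proof.
have /andP[t1 t2] := inv_golden_bounds; have [e0 e1] := (e_gt0, e_small).
split; first by apply: all_ord4; rewrite /r /=; lra.
by apply: all_ord4; apply: all_ord4; rewrite // /r /= => _; lra.
Qed.

Let r_gt0 := radius_gt0 near_golden_inventory.

Lemma near_golden_greedy : greedy_execution r w pan f.
Proof.
have /andP[t1 t2] := inv_golden_bounds; have tt := inv_golden_sqr.
have [e0 e1] := (e_gt0, e_small).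
have panE : pan = 1 + t by rewrite /t addrC subrK.
apply: all_ord4; rewrite /f /=.
- split=> //; rewrite (_ : [set _ | _]%SET = finset.set0) ?finset.setU0; last first.
    by apply/finset.setP => k; rewrite !inE.
  by apply/(packable1 r_gt0); rewrite panE /r /=; lra.
- split=> //; apply: (packable_subset r_gt0) (packable_pair r_gt0 (i := o0) (j := o1) _ _) => //.
    by apply/fintype.subsetP; apply: all_ord4; rewrite !inE.
  by rewrite panE /r /=; lra.
- split=> //; rewrite (_ : [set _ | _]%SET = finset.set0) ?finset.setU0; last first.
    by apply/finset.setP; apply: all_ord4; rewrite !inE.
  by apply/(packable1 r_gt0)/(fits_hole _ _ near_golden_inventory); rewrite /r /=; lra.
- case=> [j|] []; last first.
    move=> _ pk; have : packable r [set o0; o1; o3]%SET (r o0 + r o1).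
      rewrite (_ : r o0 + r o1 = pan); last by rewrite panE.
      apply: (packable_subset r_gt0) pk.
      by apply/fintype.subsetP; apply: all_ord4; rewrite !inE.
    by move=> /(packable_tight_triple r_gt0 (isT : o0 != o1) (isT : o0 != o3) (isT : o1 != o3)); rewrite /r /=; nra.
  move: j; apply: all_ord4 => -[// _ _] pk.
  + have : packable r [set o2; o3]%SET (region_radius r w pan (Some o0)).
      apply: (packable_subset r_gt0) pk.
      by apply/fintype.subsetP; apply: all_ord4; rewrite !inE.
    move=> /(packable_pair_le r_gt0 (isT : o2 != o3)); rewrite /= le_max /r /= => /orP[]; lra.
  + have /(fits_hole _ _ near_golden_inventory) : r o3 <= region_radius r w pan (Some o1).
      by apply: packable_le pk; rewrite // !inE eqxx.
    by rewrite /r /=; lra.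
  + have /(fits_hole _ _ near_golden_inventory) : r o3 <= region_radius r w pan (Some o2).
      by apply: packable_le pk; rewrite // !inE eqxx.
    by rewrite /r /=; lra.
Qed.

Lemma near_golden_fails : fails r w pan f.
Proof.
have /andP[t1 t2] := inv_golden_bounds; have tt := inv_golden_sqr.
have [e0 e1] := (e_gt0, e_small).
have panE : pan = 1 + t by rewrite /t addrC subrK.
move=> placedE; suff : o3 \in lexmax r w pan by rewrite -placedE inE.
apply/lexmaxP; rewrite -placedE; set S := (_ |: _)%SET.
exists (fun i => if i == o1 then Some o0 else None); split=> [i j _|x].
  case: eqP => // -> [<-]; split; first by rewrite !inE.
  by rewrite /r /=; lra.
case: x => [j|]; last first.
  apply: (packable_subset r_gt0 (B := [set o0; o2; o3]%SET)).
    by apply/fintype.subsetP; apply: all_ord4; rewrite !inE.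
  (* centres that work for both small radii up to 52 / 100 *)
  apply: (packable_triple_of_centers r_gt0 (p := (- t, 0)) (q := (9 / 10, 52 / 100))
    (x := (9 / 10, - (52 / 100)))) => //; split; rewrite /r /= ?panE.
  + suff : edist (- t, 0) (0, 0) <= t by lra.
    by apply: edist_le => /=; lra.
  + suff : edist (9 / 10, 52 / 100) (0, 0) <= 1 + t - 52 / 100 by lra.
    by apply: edist_le => /=; nra.
  + suff : edist (9 / 10, - (52 / 100)) (0, 0) <= 1 + t - 52 / 100 by lra.
    by apply: edist_le => /=; nra.
  + apply: le_trans (_ : 1 + 52 / 100 <= _); first by lra.
    by apply: le_edist => /=; nra.
  + apply: le_trans (_ : 1 + 52 / 100 <= _); first by lra.
    by apply: le_edist => /=; nra.
  + apply: le_trans (_ : 104 / 100 <= _); first by lra.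
    by apply: le_edist => /=; nra.
have [-> | j0] := eqVneq j o0.
  apply: (packable_subset r_gt0 (B := [set o1]%SET)).
    by apply/fintype.subsetP; apply: all_ord4; rewrite !inE.
  by apply/(packable1 r_gt0)/(fits_hole _ _ near_golden_inventory); rewrite /r /=; lra.
rewrite (_ : [set _ in _ | _]%SET = finset.set0); first exact: packable0.
apply/finset.setP => i; rewrite !inE; case: ifP => _; last by rewrite andbF.
rewrite (_ : (Some o0 == Some j) = false) ?andbF //.
by apply/negbTE; apply: contra_neq j0 => -[->].
Qed.

Lemma near_golden_rho : rho r <= golden R + 6 * e.
Proof.
have /andP[t1 t2] := inv_golden_bounds; have tt := inv_golden_sqr.
have [e0 e1] := (e_gt0, e_small).
have panE : pan = 1 + t by rewrite /t addrC subrK.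
apply: bigmax_le; first by rewrite panE; lra.
move=> i _; move: i; apply: all_ord4; rewrite big_mkcond !big_ord_recl big_ord0 /r /= panE.
- by rewrite ler_pdivrMr; lra.
- by rewrite ler_pdivrMr; nra.
- by rewrite ler_pdivrMr; nra.
- by rewrite ler_pdivrMr; nra.
Qed.

End Family.

Lemma failing_ratio_near_golden (R : realType) (d : R) : 0 < d ->
  exists2 x, failing_ratios R 4 x & x <= golden R + d.
Proof.
move=> d0; pose e : R := Num.min (1 / 100) (d / 6).
have e0 : 0 < e by rewrite lt_min; apply/andP; split; lra.
have e1 : e <= 1 / 100 by rewrite ge_min lexx.
have e6 : e <= d / 6 by rewrite ge_min lexx orbT.
exists (rho (near_golden e)); last first.
  by apply: le_trans (near_golden_rho e0 e1) _; lra.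
have /andP[t1 t2] := inv_golden_bounds R.
exists 4%N, (near_golden e), (1 - (golden R - 1)), (golden R); split.
  split=> //; [exact: near_golden_inventory|lra|exact: golden_gt0].
split=> //; exists near_golden_outcome; split.
  exact: near_golden_greedy.
exact: near_golden_fails.
Qed.

(** * The threshold for four rings *)

Theorem theorem21 (R : realType) :
  (forall (n : nat) (r : 'I_n -> R) (w pan : R) (f : outcome n),
     (n <= 4)%N -> inventory r -> 0 < w -> 0 < pan ->
     greedy_execution r w pan f -> fails r w pan f ->
     golden R < rho r) /\
  tau R 4 = golden R /\
  ~ failing_ratios R 4 (tau R 4).
Proof.
have above n (r : 'I_n -> R) (w pan : R) (f : outcome n) :
    (n <= 4)%N -> inventory r -> 0 < w -> 0 < pan ->
    greedy_execution r w pan f -> fails r w pan f -> golden R < rho r.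
  by move=> n4 inv w0 _ gr fl; apply: golden_lt_rho fl.
have lb x : failing_ratios R 4 x -> golden R < x.
  move=> [n [r [w [pan [[n4 inv w0 pan0] [[f [gr fl]] ->]]]]]].
  exact: above fl.
have has_lb : has_lbound (failing_ratios R 4).
  by exists (golden R) => x /lb/ltW.
have tauE : tau R 4 = golden R.
  apply/eqP; rewrite eq_le; apply/andP; split.
    apply/ler_addgt0Pr => d /failing_ratio_near_golden[x fx].
    exact/le_trans/ge_inf.
  apply: lb_le_inf; last by move=> x /lb/ltW.
  by have [x fx _] := failing_ratio_near_golden (@ltr01 R); exists x.
by split=> //; split=> //; rewrite tauE => /lb; rewrite ltxx.
Qed.
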